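(* Let $U\subseteq\mathbb{R}^n$ be open and let $L:U\times\mathbb{R}^n\to\mathbb{R}$, $(q,\dot q)\mapsto L(q,\dot q)$, be a smooth Lagrangian whose Hessian $\frac{\partial^2 L}{\partial\dot q\partial\dot q}(q,\dot q)$ is invertible everywhere. Define the surrogate Lagrangian $$\hat L(q,\dot q)=L+\frac{h^2}{24}\Big(-2\,\frac{\partial L}{\partial q}\ddot q+\dot q^{T}\frac{\partial^2 L}{\partial q\partial q}\dot q+\ddot q^{T}\frac{\partial^2 L}{\partial\dot q\partial\dot q}\ddot q+2\,\ddot q^{T}\frac{\partial^2 L}{\partial q\partial\dot q}\dot q\Big),$$ where all derivatives of $L$ are evaluated at $(q,\dot q)$, and $\ddot q$ stands for the function of $(q,\dot q)$ given by the Euler--Lagrange equation of $L$, namely $\ddot q=\big(\frac{\partial^2 L}{\partial\dot q\partial\dot q}\big)^{-1}\big(\frac{\partial L}{\partial q}-\frac{\partial^2 L}{\partial q\partial\dot q}\dot q\big)$. Let $\hat L_{\mathrm m}$ be the modified Lagrangian of $\hat L$ for the midpoint variational integrator (see context). Then, as formal power series in $h$, $$\hat L_{\mathrm m}(q,\dot q)=L(q,\dot q)+O(h^4),$$ and consequently the Euler--Lagrange equation of $\hat L_{\mathrm m}$ satisfies $$\ddot q=\Big(\frac{\partial^2\hat L_{\mathrm m}}{\partial\dot q\partial\dot q}\Big)^{-1}\Big(\frac{\partial\hat L_{\mathrm m}}{\partial q}-\frac{\partial^2\hat L_{\mathrm m}}{\partial q\partial\dot q}\dot q\Big)=\Big(\frac{\partial^2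 L}{\partial\dot q\partial\dot q}\Big)^{-1}\Big(\frac{\partial L}{\partial q}-\frac{\partial^2 L}{\partial q\partial\dot q}\dot q\Big)+O(h^4).$$
   Context: Conventions: $\frac{\partial^2 L}{\partial q\partial\dot q}$ is the matrix with $(i,j)$ entry $\frac{\partial^2 L}{\partial\dot q_i\partial q_j}$; $\frac{\partial L}{\partial q}\ddot q$ denotes $\sum_i\frac{\partial L}{\partial q_i}\ddot q_i$. For formal power series in $h$ whose coefficients are smooth functions on $U\times\mathbb{R}^n$, $A=B+O(h^k)$ means that the coefficients of $h^0,\dots,h^{k-1}$ in $A$ and $B$ coincide. Midpoint variational integrator: for a Lagrangian $\Lambda$ and time step $h$ the discrete Lagrangian is $\Lambda_{\mathrm d}(q_k,q_{k+1})=h\,\Lambda\big(\frac{q_k+q_{k+1}}{2},\frac{q_{k+1}-q_k}{h}\big)$, and the integrator is given by the discrete Euler--Lagrange equations $D_1\Lambda_{\mathrm d}(q_k,q_{k+1})+D_2\Lambda_{\mathrm d}(q_{k-1},q_k)=0$. Modified Lagrangian: it is a Lagrangian $\Lambda_{\mathrm m}$ such that (formally in $h$) $\Lambda_{\mathrm d}(q_k,q_{k+1})=\int_{t_k}^{t_{k+1}}\Lambda_{\mathrm m}\,dt$, $h=t_{k+1}-t_k$, where $q_k=q(t_k)$, $q_{k+1}=q(t_{k+1})$ and $q$ is a solution of the Euler--Lagrange equation of $\Lambda_{\mathrm m}$. Precisely, let $\Lambda=\sum_{i\ge0}h^{2i}\Lambda_i(q,\dot q)$ be a (possibly finite) formal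 power series in $h^2$ with smooth coefficients and with $\frac{\partial^2\Lambda_0}{\partial\dot q\partial\dot q}$ invertible. Put $$\mathcal{M}=\Lambda\Big(\sum_{j\ge0}\frac{h^{2j}}{2^{2j}(2j)!}q^{(2j)},\ \sum_{j\ge0}\frac{h^{2j}}{2^{2j}(2j+1)!}q^{(2j+1)}\Big),$$ Taylor expanded in $h$ about $(q,\dot q)$ (this is the Taylor expansion of $\Lambda_{\mathrm d}/h$ about the midpoint in time), and $$\Lambda_{\mathrm{jet}}=\sum_{i\ge0}h^{2i}(2^{1-2i}-1)\frac{B_{2i}}{(2i)!}\frac{d^{2i}}{dt^{2i}}\mathcal{M},$$ with $B_{2i}$ the Bernoulli numbers and $\frac{d}{dt}$ the total time derivative; its coefficients are functions of $q,\dot q,\ddot q,q^{(3)},\dots$. The modified Lagrangian $\Lambda_{\mathrm m}=\sum_{i\ge0}h^{2i}\Lambda_{\mathrm m,i}(q,\dot q)$ is the unique formal power series that is obtained from $\Lambda_{\mathrm{jet}}$ by eliminating $\ddot q,q^{(3)},\dots$ by means of the Euler--Lagrange equation $\ddot q=\big(\frac{\partial^2\Lambda_{\mathrm m}}{\partial\dot q\partial\dot q}\big)^{-1}\big(\frac{\partial\Lambda_{\mathrm m}}{\partial q}-\frac{\partial^2\Lambda_{\mathrm m}}{\partial q\partial\dot q}\dot q\big)$ of $\Lambda_{\mathrm m}$ itself and its successive total time derivatives (this determines the coefficients recursively in powers of $h^2$, starting from $\Lambda_{\mathrm m,0}=\Lambda_0$). *)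

(* Defs.v *)
From mathcomp Require Import all_boot all_order all_algebra.
From mathcomp Require Import all_classical all_reals all_analysis.
Import Order.TTheory GRing.Theory Num.Theory numFieldNormedType.Exports.

Set Implicit Arguments.
Unset Strict Implicit.
Unset Printing Implicit Defensive.

Local Open Scope classical_set_scope.
Local Open Scope ring_scope.

(* A formal power series in h is the sequence of its coefficients: A k is the
   coefficient of h^k (of h^k itself, also for series in h^2). *)

Definition cst_series (T : zmodType) (a : T) (k : nat) : T :=
  if k is 0 then a else 0.

(* A = B + O(h^N) *)
Definition eq_upto (T : Type) (N : nat) (A B : nat -> T) : Prop :=
  forall k, (k < N)%N -> A k = B k.

(* Strong recursion: the value at k is computed from the list of the values
   at 0, ..., k - 1. *)
Fixpoint course_of_values (T : Type) (step : seq T -> T) (k : nat) : seq T :=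
  if k is k'.+1 then
    let s := course_of_values step k' in rcons s (step s)
  else [::].

Definition strong_rec (T : Type) (step : seq T -> T) (k : nat) : T :=
  step (course_of_values step k).

Lemma size_course_of_values (T : Type) (step : seq T -> T) k :
  size (course_of_values step k) = k.
Proof. by elim: k => //= k IH; rewrite size_rcons IH. Qed.

Lemma nth_course_of_values (T : Type) (x0 : T) (step : seq T -> T) k i :
  (i < k)%N -> nth x0 (course_of_values step k) i = strong_rec step i.
Proof.
elim: k => //= k IH; rewrite ltnS nth_rcons size_course_of_values.
by case: ltngtP => // [/IH //|->].
Qed.

(* B_k = [k = 0] - (k + 1)^-1 * \sum_(i < k) 'C(k + 1, i) * B_i *)
Definition bernoulli_step (F : fieldType) (s : seq F) : F :=
  let k := size s in
  (k == 0%N)%:R - k.+1%:R^-1 * \sum_(i < k) 'C(k.+1, i)%:R * s`_i.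

Definition bernoulli (F : fieldType) : nat -> F :=
  strong_rec (@bernoulli_step F).

Lemma bernoulliE (F : fieldType) k :
  bernoulli F k = (k == 0%N)%:R
    - k.+1%:R^-1 * \sum_(i < k) 'C(k.+1, i)%:R * bernoulli F i.
Proof.
rewrite /bernoulli {1}/strong_rec /bernoulli_step size_course_of_values.
by congr (_ - _ * _); apply: eq_bigr => i _; rewrite nth_course_of_values.
Qed.

(* The inverse of a formal power series of matrices whose constant term is
   invertible: B_k = A_0^-1 ([k = 0] - \sum_(i < k) A_(k - i) B_i). *)
Definition mx_series_inv (R : comUnitRingType) (n : nat)
    (A : nat -> 'M[R]_n) : nat -> 'M[R]_n :=
  strong_rec (fun s : seq 'M[R]_n => let k := size s in
    invmx (A 0%N) *m ((k == 0%N)%:R%:M - \sum_(i < k) A (k - i)%N *m s`_i)).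

Lemma mx_series_invE (R : comUnitRingType) (n : nat) (A : nat -> 'M[R]_n) k :
  mx_series_inv A k = invmx (A 0%N) *m ((k == 0%N)%:R%:M
    - \sum_(i < k) A (k - i)%N *m mx_series_inv A i).
Proof.
rewrite /mx_series_inv {1}/strong_rec size_course_of_values.
by congr (_ *m (_ - _)); apply: eq_bigr => i _; rewrite nth_course_of_values.
Qed.

(* Keeps conversion from unfolding the recursion; use mx_series_invE. *)
#[global] Opaque mx_series_inv.

Lemma mx_series_inv_local (R : comUnitRingType) (n : nat)
    (A B : nat -> 'M[R]_n) k :
  (forall m, (m <= k)%N -> A m = B m) -> mx_series_inv A k = mx_series_inv B k.
Proof.
elim/ltn_ind: k => k IH eqAB; rewrite mx_series_invE [RHS]mx_series_invE.
rewrite (eqAB _ (leq0n k)); congr (_ *m (_ - _)).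
apply: eq_bigr => i _; rewrite (eqAB _ (leq_subr i k)) IH // => m mi.
by apply: eqAB; exact: leq_trans mi (ltnW (ltn_ord i)).
Qed.

Lemma mulmx_series_inv (R : comUnitRingType) (n : nat) (A : nat -> 'M[R]_n) k :
  A 0%N \in unitmx ->
  \sum_(i < k.+1) A (k - i)%N *m mx_series_inv A i = cst_series 1%:M k.
Proof.
move=> uA; rewrite big_ord_recr /= subnn (mx_series_invE A k).
rewrite mulKVmx // addrC subrK; case: k => [|k] //=.
by apply/matrixP => i j; rewrite !mxE mul0rn.
Qed.

(* f is C^k on the open set W. *)
Fixpoint Ck_on (R : realType) (V W : normedModType R) (k : nat) (D : set V)
    (f : V -> W) : Prop :=
  if k is k'.+1 then
    (forall x, D x -> differentiable f x) /\
    (forall v, Ck_on k' D ('D_v f))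
  else forall x, D x -> {for x, continuous f}.

Definition smooth_on (R : realType) (V W : normedModType R) (D : set V)
    (f : V -> W) : Prop := forall k, Ck_on k D f.

(* Functions of (q, q') are functions of z = (q, v) : 'cV_n * 'cV_n. They are
   total; only their values over U `*` setT, U open, are relevant. *)
Section Lagrangians.
Variables (R : realType) (n : nat).
Local Notation V := 'cV[R]_n.
Local Notation state := ('cV[R]_n * 'cV[R]_n)%type.

Definition dot (u w : V) : R := (u^T *m w) 0 0.

Definition partial_q (W : normedModType R) (i : 'I_n) (f : state -> W) :
  state -> W := 'D_((delta_mx i 0 : V, 0 : V) : state) f.

Definition partial_v (W : normedModType R) (i : 'I_n) (f : state -> W) :
  state -> W := 'D_((0 : V, delta_mx i 0 : V) : state) f.

Definition grad_q (L : state -> R) (z : state) : V :=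
  \col_i partial_q i L z.

Definition hess_qq (L : state -> R) (z : state) : 'M[R]_n :=
  \matrix_(i, j) partial_q i (partial_q j L) z.

Definition hess_vv (L : state -> R) (z : state) : 'M[R]_n :=
  \matrix_(i, j) partial_v i (partial_v j L) z.

Definition hess_qv (L : state -> R) (z : state) : 'M[R]_n :=
  \matrix_(i, j) partial_v i (partial_q j L) z.

(* The acceleration given by the Euler-Lagrange equation of L. *)
Definition el_acc (L : state -> R) (z : state) : V :=
  invmx (hess_vv L z) *m (grad_q L z - hess_qv L z *m z.2).

Definition surrogate (L : state -> R) (k : nat) (z : state) : R :=
  match k with
  | 0 => L z
  | 2 => let v := z.2 in let a := el_acc L z in
      24%:R^-1 * (- 2%:R * dot (grad_q L z) a
                  + dot v (hess_qq L z *m v)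
                  + dot a (hess_vv L z *m a)
                  + 2%:R * dot a (hess_qv L z *m v))
  | _ => 0
  end.

(* The Euler-Lagrange acceleration of a Lagrangian that is a formal power
   series: the same formula as el_acc, in the ring of formal power series. *)
Definition el_acc_series (Lm : nat -> state -> R) (k : nat) (z : state) : V :=
  \sum_(l < k.+1) mx_series_inv (fun m => hess_vv (Lm m) z) l
    *m (grad_q (Lm (k - l)%N) z - hess_qv (Lm (k - l)%N) z *m z.2).

(* The coefficient of h^k in the Taylor expansion of
   f (\sum_m h^m g_m) about g_0. *)
Definition subst_coef (X : lmodType R) (f : X -> R) (g : nat -> X) (k : nat) :
    R :=
  k`!%:R^-1 * derive1n k (fun h : R => f (\sum_(m < k.+1) h ^+ m *: g m)) 0.

(* The same for a formal power series \sum_l h^l A_l of functions. *)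
Definition series_subst (X : lmodType R) (A : nat -> X -> R) (g : nat -> X)
    (k : nat) : R :=
  \sum_(l < k.+1) subst_coef (A l) g (k - l).

(* A jet is a sequence (q, q', q'', ...): j k stands for q^(k). *)
Definition jet : Type := nat -> V.

(* The derivative of F with respect to the i-th component of q^(k). *)
Definition jet_partial (k : nat) (i : 'I_n) (F : jet -> R) (j : jet) : R :=
  derive1 (fun s : R =>
    F (fun l => if l == k then j l + s *: delta_mx i 0 else j l)) 0.

(* The total time derivative. For F depending on finitely many q^(k) only
   finitely many terms of the sum over k are nonzero. *)
Definition total_derivative (F : jet -> R) (j : jet) : R :=
  \sum_(k \in [set: nat]) \sum_(i < n) jet_partial k i F j * j k.+1 i 0.

(* The coefficient of h^m in the two arguments of Lambda in M. *)
Definition midpoint_expansion (j : jet) (m : nat) : state :=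
  if odd m then 0 else
  ((2%:R ^+ m * m`!%:R)^-1 *: j m, (2%:R ^+ m * (m.+1)`!%:R)^-1 *: j m.+1).

Definition midpoint_series (Lam : nat -> state -> R) (k : nat) (j : jet) : R :=
  series_subst Lam (midpoint_expansion j) k.

Definition jet_lagrangian (Lam : nat -> state -> R) (k : nat) (j : jet) : R :=
  \sum_(i < k./2.+1) (2%:R / 2%:R ^+ (2 * i) - 1)
    * (bernoulli R (2 * i) / (2 * i)`!%:R)
    * iter (2 * i) total_derivative (midpoint_series Lam (k - 2 * i)) j.

(* The total time derivative of a formal power series g of functions of
   (q, q'), with q'' eliminated by the Euler-Lagrange equation of Lm. *)
Definition onshell_derivative (Lm : nat -> state -> R) (g : nat -> state -> V)
    (k : nat) (z : state) : V :=
  \sum_(i < n) z.2 i 0 *: partial_q i (g k) z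
  + \sum_(l < k.+1) \sum_(i < n)
      el_acc_series Lm (k - l) z i 0 *: partial_v i (g l) z.

(* q^(p) as a formal power series of functions of (q, q'), by the
   Euler-Lagrange equation of Lm and its successive time derivatives. *)
Fixpoint onshell (Lm : nat -> state -> R) (p : nat) : nat -> state -> V :=
  match p with
  | 0 => fun k z => cst_series z.1 k
  | 1 => fun k z => cst_series z.2 k
  | 2 => el_acc_series Lm
  | p'.+1 => onshell_derivative Lm (onshell Lm p')
  end.

Definition eliminate (Lm : nat -> state -> R) (A : nat -> jet -> R)
    (k : nat) (z : state) : R :=
  series_subst A (fun m => (fun p => onshell Lm p m z) : jet) k.

(* Lm is the modified Lagrangian of Lam over U. This fixed-point equation has
   exactly one solution over U (modified_lagrangian_exists,
   modified_lagrangian_unique), so neither the smoothness of the coefficients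
   of Lm nor the vanishing of those of odd powers of h is imposed. *)
Definition modified_lagrangian (U : set V) (Lam Lm : nat -> state -> R) :
    Prop :=
  forall k z, U z.1 -> Lm k z = eliminate Lm (jet_lagrangian Lam) k z.

Lemma partial_q_local (W : normedModType R) (U : set V) i (f g : state -> W) :
  open U -> (forall z, U z.1 -> f z = g z) ->
  forall z, U z.1 -> partial_q i f z = partial_q i g z.
Proof.
move=> oU fg z Uz; rewrite /partial_q; apply: near_eq_derive.
have oU1 : open [set z : state | U z.1].
  by apply: open_comp => // y _; exact: cvg_fst.
by have := open_nbhs_nbhs (conj oU1 Uz : open_nbhs z _); apply: filterS => y /fg.
Qed.

Lemma partial_v_local (W : normedModType R) (U : set V) i (f g : state -> W) :
  open U -> (forall z, U z.1 -> f z = g z) ->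
  forall z, U z.1 -> partial_v i f z = partial_v i g z.
Proof.
move=> oU fg z Uz; rewrite /partial_v; apply: near_eq_derive.
have oU1 : open [set z : state | U z.1].
  by apply: open_comp => // y _; exact: cvg_fst.
by have := open_nbhs_nbhs (conj oU1 Uz : open_nbhs z _); apply: filterS => y /fg.
Qed.

Lemma el_acc_series_local (U : set V) (Lm Lm' : nat -> state -> R) k :
  open U ->
  (forall m z, (m <= k)%N -> U z.1 -> Lm m z = Lm' m z) ->
  forall z, U z.1 -> el_acc_series Lm k z = el_acc_series Lm' k z.
Proof.
move=> oU eqL z Uz.
have hqE m : (m <= k)%N -> grad_q (Lm m) z = grad_q (Lm' m) z.
  move=> mk; apply/colP => i; rewrite [LHS]mxE [RHS]mxE.
  by apply: (partial_q_local _ oU) => // y; exact: eqL.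
have hvE m : (m <= k)%N -> hess_vv (Lm m) z = hess_vv (Lm' m) z.
  move=> mk; apply/matrixP => i j; rewrite [LHS]mxE [RHS]mxE.
  apply: (partial_v_local _ oU) => // y Uy.
  by apply: (partial_v_local _ oU) => // x; exact: eqL.
have hqvE m : (m <= k)%N -> hess_qv (Lm m) z = hess_qv (Lm' m) z.
  move=> mk; apply/matrixP => i j; rewrite [LHS]mxE [RHS]mxE.
  apply: (partial_v_local _ oU) => // y Uy.
  by apply: (partial_q_local _ oU) => // x; exact: eqL.
rewrite /el_acc_series; apply: eq_bigr => l _.
have kl : (k - l <= k)%N := leq_subr _ _.
rewrite (hqE _ kl) (hqvE _ kl).
apply: (congr1 (fun B => B *m _)); apply: mx_series_inv_local => m ml.
by apply: hvE; rewrite (leq_trans ml) // -ltnS.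
Qed.

Lemma onshell_local (U : set V) (Lm Lm' : nat -> state -> R) k :
  open U ->
  (forall m z, (m <= k)%N -> U z.1 -> Lm m z = Lm' m z) ->
  forall p m z, (m <= k)%N -> U z.1 -> onshell Lm p m z = onshell Lm' p m z.
Proof.
move=> oU eqL.
have elE m z : (m <= k)%N -> U z.1 ->
    el_acc_series Lm m z = el_acc_series Lm' m z.
  move=> mk Uz; apply: (el_acc_series_local oU) => // i y im.
  by apply: eqL; exact: leq_trans im mk.
elim=> [//|[//|[|p]] IH] m z mk Uz; first exact: elE.
rewrite -[onshell _ _]/(onshell_derivative Lm (onshell Lm p.+2)).
rewrite -[onshell Lm' _]/(onshell_derivative Lm' (onshell Lm' p.+2)).
rewrite /onshell_derivative; apply: (congr2 +%R).
  apply: eq_bigr => i _; apply: (congr1 (fun x => _ *: x)).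
  by apply: (partial_q_local _ oU) Uz => y; exact: IH.
apply: eq_bigr => l _; apply: eq_bigr => i _.
rewrite (elE _ _ (leq_trans (leq_subr _ _) mk) Uz).
apply: (congr1 (fun x => _ *: x)); apply: (partial_v_local _ oU) Uz => y.
by apply: IH; apply: leq_trans mk; rewrite -ltnS.
Qed.

Lemma jet_lagrangian0 (Lam : nat -> state -> R) (j : jet) :
  jet_lagrangian Lam 0 j = Lam 0%N (j 0%N, j 1%N).
Proof.
rewrite /jet_lagrangian big_ord1 /= muln0 expr0 divr1 fact0 divr1.
rewrite bernoulliE big_ord0 mulr0 subr0 mulr1.
rewrite /midpoint_series /series_subst big_ord1 /subst_coef /= big_ord1 /=.
rewrite fact0 invr1 mul1r expr0 scale1r /midpoint_expansion /= !expr0 !mul1r.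
by rewrite invr1 !scale1r [2%:R - 1](_ : _ = 1) ?mul1r // -[2%:R]/(1 + 1) addrK.
Qed.

Lemma eq_subst_coef (X : lmodType R) (f : X -> R) (g g' : nat -> X) k :
  (forall h : R, f (\sum_(m < k.+1) h ^+ m *: g m)
               = f (\sum_(m < k.+1) h ^+ m *: g' m)) ->
  subst_coef f g k = subst_coef f g' k.
Proof. by move=> fgg'; rewrite /subst_coef (funext fgg'). Qed.

Lemma eliminate_local (U : set V) (Lam Lm Lm' : nat -> state -> R) k :
  open U ->
  (forall m z, (m < k)%N -> U z.1 -> Lm m z = Lm' m z) ->
  forall z, U z.1 -> eliminate Lm (jet_lagrangian Lam) k z
                   = eliminate Lm' (jet_lagrangian Lam) k z.
Proof.
move=> oU eqL z Uz; rewrite /eliminate /series_subst; apply: eq_bigr => l _.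
apply: eq_subst_coef => h.
case: l => -[|l] lk /=.
  by rewrite !jet_lagrangian0 !fct_sumE.
apply: (congr1 (jet_lagrangian Lam l.+1)).
apply: eq_bigr => m _; apply: (congr1 (fun x => _ *: x)).
apply/funext => p; case: k => [//|k] in eqL lk m *.
apply: (onshell_local oU (k := k)) => //.
by rewrite -ltnS (leq_trans (ltn_ord m)) // ltnS subSS leq_subr.
Qed.

Lemma modified_lagrangian_unique (U : set V) (Lam Lm Lm' : nat -> state -> R) :
  open U -> modified_lagrangian U Lam Lm -> modified_lagrangian U Lam Lm' ->
  forall k z, U z.1 -> Lm k z = Lm' k z.
Proof.
move=> oU mL mL' k; elim/ltn_ind: k => k IH z Uz.
rewrite mL // mL' //; apply: (eliminate_local _ oU) => // m y mk.
exact: IH.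
Qed.

Lemma modified_lagrangian_exists (U : set V) (Lam : nat -> state -> R) :
  exists Lm, modified_lagrangian U Lam Lm.
Proof.
pose T Lm : nat -> state -> R := eliminate Lm (jet_lagrangian Lam).
have T_local Lm Lm' k : (forall m, (m < k)%N -> Lm m = Lm' m) ->
    T Lm k = T Lm' k.
  move=> eqL; apply/funext => z.
  apply: (eliminate_local (U := setT) _ openT) => // m y mk _.
  by rewrite eqL.
pose S N := iter N T (fun _ _ => 0).
have S_step N m : (m < N)%N -> S N m = S N.+1 m.
  elim: N m => // N IH m mN; apply: T_local => i im; apply: IH.
  exact: leq_trans im mN.
have S_stable N m : (m < N)%N -> S N m = S m.+1 m.
  elim: N => // N IH; rewrite ltnS leq_eqVlt => /orP[/eqP -> //|mN].
  by rewrite -S_step // IH.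
exists (fun k => S k.+1 k) => k z _; congr (_ z).
by apply: (T_local (S k)) => m mk; rewrite S_stable.
Qed.

End Lagrangians.

(* Main.v *)
Require Import Defs.
From mathcomp Require Import all_boot all_order all_algebra.
From mathcomp Require Import all_classical all_reals all_analysis.
From mathcomp Require Import ring lra.
Import Order.TTheory GRing.Theory Num.Theory numFieldNormedType.Exports.

Set Implicit Arguments.
Unset Strict Implicit.
Unset Printing Implicit Defensive.

Local Open Scope classical_set_scope.
Local Open Scope ring_scope.

(* Parity: M is even in h, so only even powers of h occur in L_jet.
   The coefficient of h^2 in L_jet is, with a = q'' and b = q''',
     Lhat_2 + (1/8) L_q a + (1/24) L_v b - (1/24) D^2 L,
     D^2 L = L_q a + q'^T L_qq q' + 2 a^T L_qv q' + a^T L_vv a + L_v b.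
   The terms in q''' cancel, and what remains is
   Lhat_2(q, q') - C(q, q', q'') where C is the surrogate correction read with a
   free acceleration; it vanishes on the Euler-Lagrange acceleration of L. That
   is the acceleration used in the elimination up to order h, which also kills
   the coefficient of h^3. *)

(** * Symmetry of second derivatives *)

(** The quotients agree as functions of [h], before any limit, so derivability and the value of the
    derivative both transfer to the restriction of [f] to a line. *)
Lemma difference_quotient_line (R : numFieldType) (V W : normedModType R)
    (f : V -> W) (x w : V) (s : R) :
  (fun h : R => h^-1 *: (((fun t : R => f (x + t *: w)) \o shift s) (h *: 1)
                         - f (x + s *: w)))
  = (fun h : R => h^-1 *: ((f \o shift (x + s *: w)) (h *: w)
                           - f (x + s *: w))).
Proof.
apply/funext => h /=; congr (_ *: (f _ - _)).
by rewrite [h *: 1]mulr1 scalerDl addrCA.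
Qed.

Lemma derive_line (R : numFieldType) (V W : normedModType R)
    (f : V -> W) (x w : V) (s : R) :
  'D_1 (fun t : R => f (x + t *: w)) s = 'D_w f (x + s *: w).
Proof. by rewrite /derive difference_quotient_line. Qed.

Lemma is_derive_line (R : numFieldType) (V W : normedModType R)
    (f : V -> W) (x w : V) (s : R) :
  derivable f (x + s *: w) w ->
  is_derive s 1 (fun t : R => f (x + t *: w)) ('D_w f (x + s *: w)).
Proof.
move=> df; apply: DeriveDef; last exact: derive_line.
by rewrite /derivable difference_quotient_line.
Qed.

Section Schwarz.
Variables (R : realType) (V : normedModType R) (D : set V) (f : V -> R).
Hypothesis f_C2 : Ck_on 2 D f.

(** The mean value theorem is applied twice: in the direction [u] to
    [f (x + s *: v + t *: u) - f (x + t *: u)], then in the direction [v] to ['D_u f]. *)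
Lemma second_difference (x u v : V) (s : R) : 0 < s ->
  (forall t r, 0 <= t <= s -> 0 <= r <= s -> D (x + t *: u + r *: v)) ->
  exists t r, [/\ 0 <= t <= s, 0 <= r <= s &
    f (x + s *: u + s *: v) - f (x + s *: u) - f (x + s *: v) + f x
    = 'D_v ('D_u f) (x + t *: u + r *: v) * s * s].
Proof.
move=> s0 Dx; have [df dDf] := f_C2.
have sin : 0 <= s <= s by rewrite lexx ltW.
have zin : 0 <= (0 : R) <= s by rewrite lexx ltW.
pose g t := f (x + s *: v + t *: u) - f (x + t *: u).
pose dg t := 'D_u f (x + s *: v + t *: u) - 'D_u f (x + t *: u).
have gd t : 0 <= t <= s -> is_derive t 1 g (dg t).
  move=> ts; apply: is_deriveB.
    apply: is_derive_line; apply: diff_derivable; apply: df.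
    by rewrite addrAC; exact: Dx.
  apply: is_derive_line; apply: diff_derivable; apply: df.
  by have := Dx t 0 ts zin; rewrite scale0r addr0.
have [||t ts gE] := @MVT_segment _ g dg 0 s (ltW s0).
- by move=> t; rewrite in_itv /= => /andP[t0 ts]; apply: gd; rewrite !ltW.
- apply: derivable_within_continuous => t; rewrite in_itv /= => /gd gdt.
  exact: ex_derive.
rewrite in_itv /= in ts.
pose k r := 'D_u f (x + t *: u + r *: v).
have kd r : 0 <= r <= s ->
    is_derive r 1 k ('D_v ('D_u f) (x + t *: u + r *: v)).
  move=> rs; apply: is_derive_line; apply: diff_derivable.
  by apply: (proj1 (dDf u)); exact: Dx.
have [||r rs kE] := @MVT_segment _ k
  (fun r => 'D_v ('D_u f) (x + t *: u + r *: v)) 0 s (ltW s0).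
- by move=> r; rewrite in_itv /= => /andP[r0 rs]; apply: kd; rewrite !ltW.
- apply: derivable_within_continuous => r; rewrite in_itv /= => /kd kdr.
  exact: ex_derive.
rewrite in_itv /= in rs.
exists t, r; split=> //.
move: gE kE; rewrite /g /k /dg !scale0r !addr0 !subr0.
by rewrite ![x + _ *: v + _]addrAC => gE <-; rewrite -gE; ring.
Qed.

End Schwarz.

(** The second difference is symmetric in [u] and [v], so [second_difference] used in both orders
    equates the two mixed derivatives at two points near [x]. By continuity each is within [e / 2]
    of its value at [x]. *)
Lemma derive_sym (R : realType) (V : normedModType R) (D : set V) (f : V -> R)
    (x u v : V) :
  open D -> Ck_on 2 D f -> D x -> 'D_u ('D_v f) x = 'D_v ('D_u f) x.
Proof.
move=> oD fC2 Dx.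
have [_ dDf] := fC2.
have cont a b : {for x, continuous ('D_a ('D_b f))}.
  by apply: (proj2 (dDf b)).
apply/eqP; rewrite -subr_eq0 -normr_le0; apply/ler_addgt0Pl => e e0.
rewrite addr0.
have e20 : 0 < e / 2 by rewrite divr_gt0.
pose P y := [/\ D y, `|'D_u ('D_v f) x - 'D_u ('D_v f) y| < e / 2
  & `|'D_v ('D_u f) x - 'D_v ('D_u f) y| < e / 2].
have nP : nbhs x P.
  have n1 : \forall y \near x, D y by exact: open_nbhs_nbhs.
  have /cvgrPdist_lt /(_ _ e20) n2 := cont u v.
  have /cvgrPdist_lt /(_ _ e20) n3 := cont v u.
  apply: filterS (filterI n1 (filterI n2 n3)) => y [Dy [y2 y3]].
  exact: And3 Dy y2 y3.
pose g (p : R * R) := x + p.1 *: u + p.2 *: v.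
have gc : g p @[p --> ((0, 0) : R * R)] --> x.
  rewrite -[X in _ --> X]addr0 -[X in _ --> X + _]addr0.
  rewrite -{1}(scale0r u) -(scale0r v).
  apply: cvgD; [apply: cvgD|]; first exact: cvg_cst.
  - by apply: cvgZr_tmp; exact: cvg_fst.
  - by apply: cvgZr_tmp; exact: cvg_snd.
have gP := gc P nP.
rewrite nbhs_simpl in gP.

have /nbhs_ballP[d d0 dP] := gP.
rewrite /= in d0.
(* Halving [d] places the closed square of parameters inside the open ball of radius [d]. *)
have s0 : 0 < d / 2 by rewrite divr_gt0.
have Pg t r : 0 <= t <= d / 2 -> 0 <= r <= d / 2 -> P (x + t *: u + r *: v).
  move=> /andP[t0 td] /andP[r0 rd]; apply: (dP (t, r)).
  by split; rewrite /ball /= sub0r normrN ger0_norm //; lra.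
have [|t [r [tI rI E1]]] := second_difference fC2 (x := x) (u := u) (v := v) s0.
  by move=> t r tI rI; have [] := Pg t r tI rI.
have [|t' [r' [tI' rI' E2]]] :=
    second_difference fC2 (x := x) (u := v) (v := u) s0.
  by move=> t' r' tI' rI'; rewrite addrAC; have [] := Pg r' t' rI' tI'.
have EE : 'D_v ('D_u f) (x + t *: u + r *: v)
        = 'D_u ('D_v f) (x + r' *: u + t' *: v).
  apply: (mulIf (lt0r_neq0 s0)); apply: (mulIf (lt0r_neq0 s0)).
  apply: etrans (esym E1) _.
  rewrite (addrAC x (r' *: u)); apply: etrans _ E2.
  by rewrite (addrAC x (_ *: v)); ring.
have [_ _ Q1] := Pg t r tI rI.
have [_ Q2 _] := Pg r' t' rI' tI'.
rewrite EE distrC in Q1.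
apply: le_trans (ler_distD ('D_u ('D_v f) (x + r' *: u + t' *: v)) _ _) _.
rewrite [leRHS](splitr e); exact: ltW (ltrD Q2 Q1).
Qed.

(** * Parity in h *)

Lemma cvg_opp_dnbhs0 (R : realType) : - h @[h --> (0 : R)^'] = (0 : R)^'.
Proof.
apply/seteqP; split=> A [e /= e0 eA]; exists e => //= x /=;
  rewrite sub0r normrN => xe x0.
  by rewrite -[x]opprK; apply: eA; rewrite /= ?sub0r ?normrN ?oppr_eq0.
by apply: eA; rewrite /= ?sub0r ?normrN ?oppr_eq0.
Qed.

(* No convergence is needed: the limit of a divergent function is 0. *)
Lemma lim_oppE (R : realType) (T : Type) (F : set_system T)
    (FF : ProperFilter F) (f : T -> R) :
  lim ((- f : T -> R) @ F) = - lim (f @ F).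
Proof.
have [fc|fd] := pselect (cvg (f @ F)); first exact: limN.
have fNd : ~ cvg ((- f : T -> R) @ F) by rewrite is_cvgNE.
by rewrite (dvgP fd) (dvgP fNd) oppr0.
Qed.

Lemma derive1_opp (R : realType) (f : R -> R) : derive1 (- f) = - derive1 f.
Proof.
apply/funext => x; pose q h := h^-1 *: (f (h + x) - f x).
have E : (fun h => h^-1 *: ((- f) (h + x) - (- f) x)) = - q.
  by apply/funext => h; rewrite !fctE /q -scalerN opprB opprK addrC.
by rewrite {1}/derive1 E; exact: lim_oppE.
Qed.

(** Substituting [- h] for [h] in the difference quotient preserves the punctured neighbourhoods of
    0; the remaining sign passes through the limit by [lim_oppE]. *)
Lemma derive1_comp_opp (R : realType) (f : R -> R) (x : R) :
  derive1 (fun y => f (- y)) x = - derive1 f (- x).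
Proof.
pose q h := h^-1 *: (f (h - x) - f (- x)).
have E : (fun h => h^-1 *: (f (- (h + x)) - f (- x))) = - (q \o -%R).
  by apply/funext => h; rewrite !fctE /q opprD invrN scaleNr opprK.
rewrite {1}/derive1 E.
have -> : derive1 f (- x) = lim ((q \o -%R) @ (0 : R)^').
  by rewrite /derive1 -[in LHS]cvg_opp_dnbhs0.
exact: lim_oppE.
Qed.

(** Induction on [k]: by [derive1_comp_opp], each further derivative contributes one more sign. *)
Lemma derive1n_even (R : realType) (f : R -> R) k :
  (forall x, f (- x) = f x) ->
  forall x, derive1n k f (- x) = (-1) ^+ k * derive1n k f x.
Proof.
move=> f_even; elim: k => [|k IH] x; first by rewrite expr0 mul1r.
rewrite !derive1nS exprS mulN1r mulNr; apply: oppr_inj; rewrite opprK.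
rewrite -derive1_comp_opp (funext IH).
rewrite -signr_odd; case: odd; rewrite ?expr1 ?expr0 ?mul1r ?mulN1r.
  by under [X in derive1 X]eq_fun do rewrite mulN1r; rewrite derive1_opp.
by congr (derive1 _ _); apply/funext => y; rewrite mul1r.
Qed.

Lemma derive1n_odd_even0 (R : realType) (f : R -> R) k :
  odd k -> (forall x, f (- x) = f x) -> derive1n k f 0 = 0.
Proof.
move=> ok f_even; have := derive1n_even k f_even 0.
rewrite oppr0 -signr_odd ok expr1 mulN1r => E; lra.
Qed.

Lemma derive1n_cst (R : realType) (c : R) k :
  (0 < k)%N -> derive1n k (fun=> c : R) = (fun=> 0).
Proof.
elim: k => // -[_ _|k IH _]; rewrite derive1nS ?derive1n0 ?IH //;
  by apply/funext => x; exact: derive1_cst.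
Qed.

(** Constancy is asked only along the curve that the substitution follows, which is what elimination
    provides: a jet function may vanish on solutions without vanishing identically. *)
Lemma subst_coef_cst (R : realType) (X : lmodType R) (f : X -> R)
    (g : nat -> X) k c :
  (0 < k)%N -> (forall h : R, f (\sum_(m < k.+1) h ^+ m *: g m) = c) ->
  subst_coef f g k = 0.
Proof.
by move=> k0 fc; rewrite /subst_coef (funext fc) derive1n_cst // mulr0.
Qed.

Lemma subst_coef0 (R : realType) (X : lmodType R) (f : X -> R)
    (g : nat -> X) : subst_coef f g 0 = f (g 0%N).
Proof. by rewrite /subst_coef /= big_ord1 expr0 scale1r fact0 invr1 mul1r. Qed.

Lemma subst_coef_zero (R : realType) (X : lmodType R) (g : nat -> X) k :
  subst_coef (fun=> 0) g k = 0.
Proof.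
by case: k => [|k]; [rewrite subst_coef0|exact: (@subst_coef_cst _ _ _ _ _ 0)].
Qed.

Section MidpointExpansion.
Variables (R : realType) (n : nat).
Local Notation V := 'cV[R]_n.
Local Notation state := ('cV[R]_n * 'cV[R]_n)%type.
Implicit Types (j : jet R n) (f : state -> R).

Lemma midpoint_expansion_odd j m : odd m -> midpoint_expansion j m = 0.
Proof. by rewrite /midpoint_expansion => ->. Qed.

(** The midpoint expansion has only even powers of [h], so the composite is an even function of
    [h]. *)
Lemma subst_midpoint_odd f j k :
  odd k -> subst_coef f (midpoint_expansion j) k = 0.
Proof.
move=> ok; rewrite /subst_coef derive1n_odd_even0 ?mulr0 // => h.
congr (f _); apply: eq_bigr => m _.
have [om|em] := boolP (odd m); first by rewrite midpoint_expansion_odd ?scaler0.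
by rewrite exprNn -signr_odd (negbTE em) expr0 mul1r.
Qed.

(** For odd [k], one of [l] and [k - l] is odd: either [Lam l] is zero or [subst_midpoint_odd]
    applies. *)
Lemma midpoint_series_odd (Lam : nat -> state -> R) k :
  (forall l, odd l -> Lam l = (fun=> 0)) -> odd k ->
  midpoint_series Lam k = (fun=> 0).
Proof.
move=> Lam_even ok; apply/funext => j; rewrite /midpoint_series /series_subst.
rewrite big1 // => l _; have [ol|el] := boolP (odd l).
  by rewrite Lam_even // subst_coef_zero.
by rewrite subst_midpoint_odd // oddB ?ok ?(negbTE el) // -ltnS.
Qed.

Lemma total_derivative0 :
  total_derivative (fun=> 0 : R) = (fun=> 0) :> (jet R n -> R).
Proof.
apply/funext => j; rewrite /total_derivative fsbig1 // => k _.
rewrite big1 // => i _; rewrite /jet_partial.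
have -> : derive1 (fun=> 0 : R) 0 = 0 by exact: derive1_cst.
by rewrite mul0r.
Qed.

Lemma jet_lagrangian_odd (Lam : nat -> state -> R) k :
  (forall l, odd l -> Lam l = (fun=> 0)) -> odd k ->
  jet_lagrangian Lam k = (fun=> 0).
Proof.
move=> Lam_even ok; apply/funext => j; rewrite /jet_lagrangian big1 // => i _.
(* Subtraction on [nat] is truncated; this bound makes [k - 2 * i] exact, hence odd like [k]. *)
have ik : (2 * i <= k)%N.
  rewrite -[leqRHS]odd_double_half mul2n (leq_trans _ (leq_addl _ _)) //.
  by rewrite leq_double -ltnS.
rewrite midpoint_series_odd; [|by []|by rewrite oddB ?oddM ?ok].
suff -> : iter (2 * i) (@total_derivative R n) (fun=> 0) = (fun=> 0).
  by rewrite mulr0.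
by elim: (2 * i)%N => //= m ->; exact: total_derivative0.
Qed.

End MidpointExpansion.

(** * Total derivatives on jets *)

Section TotalDerivative.
Variables (R : realType) (n : nat).
Local Notation V := 'cV[R]_n.
Local Notation state := ('cV[R]_n * 'cV[R]_n)%type.
Local Notation jet := (jet R n).
Implicit Types (j : jet) (f : state -> R) (F G : jet -> R).

(** This is convertible to the curve inside [jet_partial], so that facts about one apply to the
    other. *)
Definition jet_shift j (k : nat) (i : 'I_n) (s : R) : jet :=
  fun l => if l == k then j l + s *: delta_mx i 0 else j l.

Lemma jet_shift0 j k i : jet_shift j k i 0 = j.
Proof.
by apply/funext => l; rewrite /jet_shift scale0r addr0; case: ifP.
Qed.

(* M ranges over all numbers above N so that bounds for two functions can be
   replaced by their maximum. *)
Definition is_total_derivative F j (d : R) : Prop :=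
  exists (p : nat -> 'I_n -> R) (N : nat),
  [/\ forall k i, is_derive (0 : R) 1 (fun s => F (jet_shift j k i s)) (p k i),
      forall k i, (N <= k)%N -> p k i = 0
    & forall M, (N <= M)%N ->
        d = \sum_(k < M) \sum_(i < n) p k i * j k.+1 i 0].

(** The sum in [total_derivative] ranges over all of [nat]; the terms from [N] on vanish, which
    reduces it to the finite sum. *)
Lemma total_derivativeE F j d :
  is_total_derivative F j d -> total_derivative F j = d.
Proof.
move=> [p [N [Fp p0 dE]]].
have pE k i : jet_partial k i F j = p k i.
  by have ? := Fp k i; rewrite /jet_partial derive1E derive_val.
rewrite (dE N (leqnn N))
  (fsbig_ord _ N (fun k => \sum_(i < n) p k i * j k.+1 i 0)).
transitivity (\sum_(k \in [set: nat]) \sum_(i < n) p k i * j k.+1 i 0).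
  by apply: eq_fsbigr => k _; apply: eq_bigr => i _; rewrite pE.
apply/esym; apply: fsbig_widen => // k [_ /= /negP]; rewrite -leqNgt => Nk.
by rewrite big1 // => i _; rewrite p0 // mul0r.
Qed.

Lemma is_total_derivativeD F G j dF dG :
  is_total_derivative F j dF -> is_total_derivative G j dG ->
  is_total_derivative (fun j => F j + G j) j (dF + dG).
Proof.
move=> [p [N [Fp p0 pE]]] [q [M [Gq q0 qE]]].
exists (fun k i => p k i + q k i), (maxn N M); split.
- by move=> k i; exact: is_deriveD.
- by move=> k i; rewrite geq_max => /andP[? ?]; rewrite p0 // q0 // addr0.
move=> K; rewrite geq_max => /andP[NK MK]; rewrite (pE K) // (qE K) //.
rewrite -big_split; apply: eq_bigr => k _.
by rewrite -big_split; apply: eq_bigr => i _; rewrite mulrDl.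
Qed.

Lemma is_total_derivativeM F G j dF dG :
  is_total_derivative F j dF -> is_total_derivative G j dG ->
  is_total_derivative (fun j => F j * G j) j (F j * dG + G j * dF).
Proof.
move=> [p [N [Fp p0 pE]]] [q [M [Gq q0 qE]]].
exists (fun k i => F j * q k i + G j * p k i), (maxn N M); split.
- move=> k i; have ? := Fp k i; have ? := Gq k i.
  have := is_deriveM (Fp k i) (Gq k i); rewrite jet_shift0; exact.
- move=> k i; rewrite geq_max => /andP[? ?].
  by rewrite p0 // q0 // !mulr0 addr0.
move=> K; rewrite geq_max => /andP[NK MK]; rewrite (pE K) // (qE K) //.
rewrite !mulr_sumr -big_split; apply: eq_bigr => k _.
rewrite !mulr_sumr -big_split; apply: eq_bigr => i _.
by rewrite mulrDl !mulrA.
Qed.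

Lemma is_total_derivative0 j : is_total_derivative (fun=> 0) j 0.
Proof.
exists (fun _ _ => 0), 0%N; split=> // [k i|M _]; first exact: is_derive_cst.
by rewrite big1 // => k _; rewrite big1 // => i _; rewrite mul0r.
Qed.

Lemma is_total_derivative_sum m (F : 'I_m -> jet -> R) j (d : 'I_m -> R) :
  (forall i, is_total_derivative (F i) j (d i)) ->
  is_total_derivative (fun j => \sum_(i < m) F i j) j (\sum_(i < m) d i).
Proof.
move=> Fd; elim: m => [|m IH] in F d Fd *.
  by rewrite big_ord0; under eq_fun do rewrite big_ord0;
     exact: is_total_derivative0.
rewrite big_ord_recr; under eq_fun do rewrite big_ord_recr.
by apply: is_total_derivativeD => //; exact: IH.
Qed.

Lemma is_total_derivative_coord j k i :
  is_total_derivative (fun j => j k i 0) j (j k.+1 i 0).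
Proof.
exists (fun l i' => ((l == k) && (i' == i))%:R), k.+1; split.
- move=> l i'.
  have -> : (fun s => jet_shift j l i' s k i 0) =
      (fun s => j k i 0 + s *: ((l == k) && (i' == i))%:R).
    apply/funext => s; rewrite /jet_shift [k == l]eq_sym.
    case: eqP => _ /=; last by rewrite scaler0 addr0.
    by rewrite !mxE eqxx andbT eq_sym.
  have := is_derive_line (f := id) (x := j k i 0)
    (w := ((l == k) && (i' == i))%:R) (s := 0) (@derivable_id _ _ _ _).
  by rewrite derive_id.
- by move=> l i' /=; case: eqP => [->|//]; rewrite ltnn.
move=> M kM; rewrite (bigD1 (Ordinal kM)) //= (bigD1 i) //= !eqxx mul1r.
rewrite big1 ?addr0 => [|i' /negbTE ->]; last by rewrite andbF mul0r.
rewrite big1 ?addr0 // => l lk; rewrite big1 // => i' _.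
by rewrite -(inj_eq val_inj) in lk; rewrite (negbTE lk) mul0r.
Qed.

(** The differential is linear, and [(u, w)] is expanded in the coordinate directions of [q] and
    [q']. *)
Lemma derive_state f (z : state) (u w : V) : differentiable f z ->
  'D_(u, w) f z = \sum_(i < n) partial_q i f z * u i 0
                  + \sum_(i < n) partial_v i f z * w i 0.
Proof.
move=> df; have sum_delta (a : V) : a = \sum_(i < n) a i 0 *: delta_mx i 0.
  by rewrite [LHS]matrix_sum_delta; apply: eq_bigr => i _; rewrite big_ord1.
have sum0 (a : V) : \sum_(i < n) a i 0 *: (0 : V) = 0.
  by rewrite big1 // => i _; rewrite scaler0.
have uwE : (u, w) = \sum_(i < n) u i 0 *: ((delta_mx i 0 : V, 0 : V) : state)
                  + \sum_(i < n) w i 0 *: ((0 : V, delta_mx i 0 : V) : state).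
  apply/eqP; rewrite xpair_eqE /=; apply/andP; split; apply/eqP.
    by rewrite !raddf_sum /= sum0 addr0 -sum_delta.
  by rewrite !raddf_sum /= sum0 add0r -sum_delta.
rewrite deriveE // uwE linearD !linear_sum.
by congr (_ + _); apply: eq_bigr => i _;
  rewrite linearZ /= mulrC /partial_q /partial_v deriveE.
Qed.

(** The chain rule along [(q', q'')]. Only the slots 0 and 1 of the jet enter, hence the bound 2. *)
Lemma is_total_derivative_state f j :
  differentiable f (j 0%N, j 1%N) ->
  is_total_derivative (fun j => f (j 0%N, j 1%N)) j
    ('D_(j 1%N, j 2%N) f (j 0%N, j 1%N)).
Proof.
move=> df; set z := (j 0%N, j 1%N).
exists (fun k i => match k with 0 => partial_q i f z | 1 => partial_v i f z
  | _ => 0 end), 2%N; split.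
- move=> [|[|k]] i; last exact: (is_derive_cst (f z)).
    have -> : (fun s => f (jet_shift j 0 i s 0, jet_shift j 0 i s 1)) =
      (fun s => f (z + s *: ((delta_mx i 0 : V, 0 : V) : state))).
      apply/funext => s; congr (f _).
      by rewrite /jet_shift /= -[RHS]/(_ + _ *: _, _ + _ *: _) scaler0 addr0.
    have := @is_derive_line _ _ _ f z ((delta_mx i 0 : V, 0 : V) : state) 0.
    by rewrite scale0r addr0; apply; exact: diff_derivable.
  have -> : (fun s => f (jet_shift j 1 i s 0, jet_shift j 1 i s 1)) =
    (fun s => f (z + s *: ((0 : V, delta_mx i 0 : V) : state))).
    apply/funext => s; congr (f _).
    by rewrite /jet_shift /= -[RHS]/(_ + _ *: _, _ + _ *: _) scaler0 addr0.
  have := @is_derive_line _ _ _ f z ((0 : V, delta_mx i 0 : V) : state) 0.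
  by rewrite scale0r addr0; apply; exact: diff_derivable.
- by move=> [|[|k]].
move=> [|[|M]] // _; rewrite derive_state // 2!big_ord_recl /= addrA.
rewrite [X in _ = _ + X]big1 ?addr0 // => k _.
by rewrite big1 // => i _; rewrite mul0r.
Qed.

(** Iterating the total derivative requires this: the formula for the first derivative of [L] is
    available only over [U]. *)
Lemma is_total_derivative_local (U : set V) F G j d :
  open U -> (forall j, U (j 0%N) -> F j = G j) -> U (j 0%N) ->
  is_total_derivative F j d -> is_total_derivative G j d.
Proof.
move=> oU FG Uj [p [N [Fp p0 pE]]]; exists p, N; split=> // k i.
apply: near_eq_is_derive (Fp k i).
suff nU : \forall s \near (0 : R), U (jet_shift j k i s 0%N).
  by apply: filterS nU => s; exact: FG.
(* Only a shift of [q] itself, the case [k = 0], can leave [U]; openness of [U] handles it for small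
   [s]. *)
have [k0|k0] := eqVneq 0%N k; last first.
  have Us s : U (jet_shift j k i s 0%N) by rewrite /jet_shift (negbTE k0).
  exact: filterE Us.
have c0 : (j 0%N + s *: delta_mx i 0) @[s --> (0 : R)] --> (j 0%N : V).
  rewrite -[X in _ --> X]addr0 -(scale0r (delta_mx i 0 : V)).
  by apply: cvgD; [exact: cvg_cst|apply: cvgZr_tmp; exact: cvg_id].
have nU := c0 _ (open_nbhs_nbhs (conj oU Uj)); rewrite nbhs_simpl in nU.
have {}nU : \forall s \near (0 : R), U (j 0%N + s *: delta_mx i 0) := nU.
by apply: filterS nU => s; rewrite /jet_shift -k0 eqxx.
Qed.

End TotalDerivative.

(** * The coefficient of h^2 *)

(** The first derivative in [h] is [dpsi (h ^+ 2) * (2 * h)]. Differentiating this product at 0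
    leaves only the term in which [2 * h] is differentiated. *)
Lemma derive2_along_square (R : realType) (V : normedModType R) (D : set V)
    (f : V -> R) (x w : V) :
  open D -> Ck_on 2 D f -> D x ->
  derive1n 2 (fun h => f (x + h ^+ 2 *: w)) 0 = 2 * 'D_w f x.
Proof.
move=> oD [df dDf] Dx.
pose psi (t : R) : R := f (x + t *: w).
pose dpsi (t : R) : R := 'D_w f (x + t *: w).
have sq (h : R) : is_derive h 1 (fun y : R => y ^+ 2) (2 * h).
  have idd := is_derive_id h (1 : R).
  apply: is_derive_eq (is_deriveM idd idd) _.
  by rewrite /= [h *: 1]mulr1 mulr_natl.
have psiE h : D (x + h ^+ 2 *: w) ->
    derive1 (fun y => psi (y ^+ 2)) h = dpsi (h ^+ 2) * (2 * h).
  move=> Dh; have dp : is_derive (h ^+ 2) 1 psi (dpsi (h ^+ 2)).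
    by apply: is_derive_line; apply: diff_derivable; exact: df.
  rewrite derive1E.
  by have [] := @is_derive1_comp _ _ (fun y => y ^+ 2) _ _ _ dp (sq h).
have c0 : (x + h ^+ 2 *: w) @[h --> (0 : R)] --> x.
  rewrite -[X in _ --> X]addr0 -(scale0r w) -[X in _ --> _ + X *: _](expr0n R 2).
  apply: cvgD; [exact: cvg_cst|apply: cvgZr_tmp].
  exact: (@exprn_continuous R 2 0).
have nD := c0 _ (open_nbhs_nbhs (conj oD Dx)); rewrite nbhs_simpl in nD.
have {}nD : \forall h \near (0 : R), D (x + h ^+ 2 *: w) := nD.
rewrite -[LHS]/(derive1 (derive1 (fun y => psi (y ^+ 2))) 0) derive1E.
(* The formula for the first derivative holds only while [x + h ^+ 2 *: w] stays in [D], that is,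
   for [h] near 0. *)
rewrite (@near_eq_derive _ _ _ _ (fun h : R => dpsi (h ^+ 2) * (2 * h))); last first.
  by apply: filterS nD => h; exact: psiE.
have Dx0 : D (x + (0 : R) ^+ 2 *: w) by rewrite expr0n scale0r addr0.
have ddp : is_derive ((0 : R) ^+ 2) 1 dpsi
    ('D_w ('D_w f) (x + (0 : R) ^+ 2 *: w)).
  apply: is_derive_line; apply: diff_derivable.
  exact: (proj1 (dDf w)).
have dlin : is_derive (0 : R) 1 (fun h : R => 2 * h) 2.
  by apply: is_derive_eq (is_deriveZ 2 (is_derive_id (0 : R) (1 : R))) (mulr1 _).
have dpsi_sq := @is_derive1_comp _ _ (fun y => y ^+ 2) _ _ _ ddp (sq 0).
have [_ ->] := is_deriveM dpsi_sq dlin.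
by rewrite /= mulr0 scale0r addr0 /dpsi expr0n scale0r addr0 [_ *: _]mulrC.
Qed.

Lemma bernoulli2 (F : numFieldType) : bernoulli F 2 = 6^-1.
Proof.
have b0 : bernoulli F 0 = 1 by rewrite bernoulliE big_ord0 mulr0 subr0.
have b1 : bernoulli F 1 = - 2^-1.
  by rewrite bernoulliE big_ord1 /= b0 sub0r !mulr1.
rewrite bernoulliE big_ord_recl big_ord1 /= b0 b1.
by rewrite -[bump 0 0]/1%N bin1 bin0; field.
Qed.

(** The weight is 1 for [i = 0], and (2/4 - 1) (1/6) / 2 = - 1/24 for [i = 1]. *)
Lemma jet_lagrangian2E (R : realType) (n : nat)
    (Lam : nat -> 'cV[R]_n * 'cV[R]_n -> R) (j : jet R n) :
  jet_lagrangian Lam 2 j = midpoint_series Lam 2 j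
    - 24^-1 * iter 2 (@total_derivative R n) (midpoint_series Lam 0) j.
Proof.
rewrite /jet_lagrangian -[2./2.+1]/2%N big_ord_recl big_ord1.
rewrite -[(2 * lift ord0 ord0)%N]/2%N -[(2 * ord0)%N]/0%N subn0 subnn.
rewrite bernoulli2 bernoulliE big_ord0 -[0`!]/1%N -[2`!]/2%N.
rewrite -[iter 0 _ _ j]/(midpoint_series Lam 2 j).
move: (midpoint_series _ _ _) (iter _ _ _ _) => x y.
by rewrite eqxx expr0 /=; field.
Qed.

Section MidpointSurrogate.
Variables (R : realType) (n : nat).
Local Notation V := 'cV[R]_n.
Local Notation state := ('cV[R]_n * 'cV[R]_n)%type.
Implicit Types (j : jet R n) (Lam : nat -> state -> R) (z : state) (a : V).

Lemma midpoint_expansion0 j : midpoint_expansion j 0 = (j 0%N, j 1%N).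
Proof.
by rewrite /midpoint_expansion /= expr0 mul1r fact0 invr1 !scale1r.
Qed.

Lemma midpoint_series0 Lam j : midpoint_series Lam 0 j = Lam 0%N (j 0%N, j 1%N).
Proof.
by rewrite /midpoint_series /series_subst big_ord1 subst_coef0
  midpoint_expansion0.
Qed.

Lemma open_phase_space (U : set V) : open U -> open (U `*` [set: V]).
Proof.
move=> oU; rewrite (_ : _ `*` _ = [set z : state | U z.1]).
  by apply: open_comp => // y _; exact: cvg_fst.
by apply/seteqP; split=> z //= [].
Qed.

Lemma dot_mulmx (u w : V) (M : 'M[R]_n) :
  dot u (M *m w) = \sum_(i < n) \sum_(k < n) u i 0 * (M i k * w k 0).
Proof.
rewrite /dot mxE; apply: eq_bigr => i _.
by rewrite !mxE mulr_sumr.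
Qed.

(** Exchanging the order of summation transposes [A] and [C] inside their quadratic forms and makes
    the two sums with [B] equal, whence the factor 2. *)
Lemma sum_bilinear (v a : V) (A B C : 'M[R]_n) (p q : 'I_n -> R) :
  (forall i, p i = \sum_(k < n) A k i * v k 0 + \sum_(k < n) B k i * a k 0) ->
  (forall i, q i = \sum_(k < n) B i k * v k 0 + \sum_(k < n) C k i * a k 0) ->
  \sum_(i < n) v i 0 * p i + \sum_(i < n) a i 0 * q i
  = dot v (A *m v) + dot a (C *m a) + 2 * dot a (B *m v).
Proof.
move=> pE qE; rewrite !dot_mulmx.
have -> : \sum_(i < n) v i 0 * p i
    = \sum_(i < n) \sum_(k < n) v i 0 * (A i k * v k 0)
      + \sum_(i < n) \sum_(k < n) a i 0 * (B i k * v k 0).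
  rewrite exchange_big [X in _ = _ + X]exchange_big -big_split /=.
  apply: eq_bigr => i _; rewrite pE mulrDr !mulr_sumr.
  by congr (_ + _); apply: eq_bigr => k _; ring.
have -> : \sum_(i < n) a i 0 * q i
    = \sum_(i < n) \sum_(k < n) a i 0 * (B i k * v k 0)
      + \sum_(i < n) \sum_(k < n) a i 0 * (C i k * a k 0).
  rewrite [X in _ = _ + X]exchange_big -big_split /=.
  apply: eq_bigr => i _; rewrite qE mulrDr !mulr_sumr.
  by congr (_ + _); apply: eq_bigr => k _; ring.
ring.
Qed.

Lemma dot_grad_q (L : state -> R) z a :
  dot (grad_q L z) a = \sum_(i < n) partial_q i L z * a i 0.
Proof. by rewrite /dot mxE; apply: eq_bigr => i _; rewrite !mxE. Qed.

(** With the acceleration as a free argument, the same expression serves for [q''] of a jet and, at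
    [el_acc L z], is convertible to [surrogate L 2 z]. *)
Definition surrogate_correction (L : state -> R) z a : R :=
  24%:R^-1 * (- 2%:R * dot (grad_q L z) a
              + dot z.2 (hess_qq L z *m z.2)
              + dot a (hess_vv L z *m a)
              + 2%:R * dot a (hess_qv L z *m z.2)).

Variables (U : set V) (L : state -> R).
Hypotheses (U_open : open U) (L_C2 : Ck_on 2 (U `*` [set: V]) L).

(** The chain rule gives the first derivative over [U]; the product rule applied to it yields the
    terms in [q''] and [q'''], and [sum_bilinear] collects the Hessian terms. *)
Lemma total_derivative2_lagrangian j : U (j 0%N) ->
  iter 2 (@total_derivative R n) (fun j => L (j 0%N, j 1%N)) j
  = let z := (j 0%N, j 1%N) in
    dot (grad_q L z) (j 2%N) + dot (j 1%N) (hess_qq L z *m j 1%N)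
    + dot (j 2%N) (hess_vv L z *m j 2%N) + 2 * dot (j 2%N) (hess_qv L z *m j 1%N)
    + \sum_(i < n) partial_v i L z * j 3%N i 0.
Proof.
move=> Uj; have [dL dDL] := L_C2.
have dp (u : state) (y : state) : U y.1 -> differentiable ('D_u L) y.
  by move=> Uy; apply: (proj1 (dDL u)).
pose td (j : jet R n) :=
  \sum_(i < n) partial_q i L (j 0%N, j 1%N) * j 1%N i 0
  + \sum_(i < n) partial_v i L (j 0%N, j 1%N) * j 2%N i 0.
have tdE j' : U (j' 0%N) ->
    td j' = total_derivative (fun j => L (j 0%N, j 1%N)) j'.
  move=> Uj'; have dLj : differentiable L (j' 0%N, j' 1%N) by apply: dL.
  by rewrite (total_derivativeE (is_total_derivative_state dLj)) derive_state.
set z := (j 0%N, j 1%N).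
pose dz (f : state -> R) := 'D_(j 1%N, j 2%N) f z.
have td_td : is_total_derivative td j
    (\sum_(i < n) partial_q i L z * j 2%N i 0
     + \sum_(i < n) j 1%N i 0 * dz (partial_q i L)
     + (\sum_(i < n) partial_v i L z * j 3%N i 0
        + \sum_(i < n) j 2%N i 0 * dz (partial_v i L))).
  apply: is_total_derivativeD; rewrite -big_split;
    apply: is_total_derivative_sum => i;
    apply: is_total_derivativeM; try exact: is_total_derivative_coord.
    exact: is_total_derivative_state (dp _ _ _).
  exact: is_total_derivative_state (dp _ _ _).
rewrite [LHS](total_derivativeE (is_total_derivative_local U_open tdE Uj td_td)).
cbv zeta; rewrite -/z.
have dzE u : dz ('D_u L) = \sum_(k < n) partial_q k ('D_u L) z * j 1%N k 0
                         + \sum_(k < n) partial_v k ('D_u L) z * j 2%N k 0.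
  by rewrite /dz derive_state //; exact: dp.
have dqE i : dz (partial_q i L) = \sum_(k < n) hess_qq L z k i * j 1%N k 0
                                + \sum_(k < n) hess_qv L z k i * j 2%N k 0.
  apply: etrans (dzE _) _.
  by congr (_ + _); apply: eq_bigr => k _; rewrite mxE.
(* Here the derivative in [q] is the outer one, whereas [hess_qv] takes the derivative in [q'] last:
   this is where the symmetry of second derivatives enters. *)
have dvE i : dz (partial_v i L) = \sum_(k < n) hess_qv L z i k * j 1%N k 0
                                + \sum_(k < n) hess_vv L z k i * j 2%N k 0.
  apply: etrans (dzE _) _.
  apply: congr2; apply: eq_bigr => k _; last by rewrite mxE.
  rewrite mxE; apply: (congr1 (fun x => x * _)).
  exact: (derive_sym _ _ (open_phase_space U_open) L_C2).
rewrite dot_grad_q.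
by rewrite [LHS]addrACA (sum_bilinear dqE dvE) [LHS]addrAC 2!addrA.
Qed.

(** The coefficient of [L] is half a second derivative along a curve in [h ^+ 2], so 2! cancels the
    factor 2 of [derive2_along_square]; [Lam 2] contributes its constant term. *)
Lemma midpoint_series2 Lam j : Lam 0%N = L -> Lam 1%N = (fun=> 0) ->
  U (j 0%N) ->
  midpoint_series Lam 2 j = 'D_(midpoint_expansion j 2) L (j 0%N, j 1%N)
                            + Lam 2%N (j 0%N, j 1%N).
Proof.
move=> Lam0 Lam1 Uj; rewrite /midpoint_series /series_subst.
rewrite big_ord_recl /= 2!big_ord_recl big_ord0 /= addr0 -[bump 0 0]/1%N.
rewrite -[bump 0 1]/2%N subnn subn0 Lam0 Lam1 subst_coef_zero add0r.
rewrite subst_coef0 midpoint_expansion0; congr (_ + _).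
have sumE (h : R) : \sum_(m < 3) h ^+ m *: midpoint_expansion j m
    = (j 0%N, j 1%N) + h ^+ 2 *: midpoint_expansion j 2.
  rewrite !big_ord_recl big_ord0 /= midpoint_expansion0.
  by rewrite (@midpoint_expansion_odd _ _ _ 1) // scaler0 add0r addr0 scale1r.
rewrite /subst_coef; under [X in derive1n _ X]eq_fun => h do rewrite sumE.
rewrite (derive2_along_square _ (open_phase_space U_open) L_C2) //.
by rewrite -[2`!]/2%N mulKf // pnatr_eq0.
Qed.

Lemma derive_midpoint_expansion2 j : differentiable L (j 0%N, j 1%N) ->
  let z := (j 0%N, j 1%N) in
  'D_(midpoint_expansion j 2) L z
  = 8^-1 * dot (grad_q L z) (j 2%N)
    + 24^-1 * \sum_(i < n) partial_v i L z * j 3%N i 0.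
Proof.
move=> dLz z; rewrite /midpoint_expansion [odd 2]/=.
rewrite derive_state // dot_grad_q !mulr_sumr.
have -> : (2 ^+ 2 * 2`!%:R : R) = 8 by rewrite -[2`!]/2%N; ring.
have -> : (2 ^+ 2 * 3`!%:R : R) = 24 by rewrite -[3`!]/6%N; ring.
by apply: congr2; apply: eq_bigr => i _; rewrite mxE mulrCA.
Qed.

(** The two terms in [q'''] have weights 1/24 and - 1/24 and cancel. For the product of the gradient
    in [q] with [q''], 1/8 - 1/24 = 2/24 is the opposite of the weight - 2/24 in the correction. *)
Lemma jet_lagrangian2 j : U (j 0%N) ->
  let z := (j 0%N, j 1%N) in
  jet_lagrangian (surrogate L) 2 j
  = surrogate_correction L z (el_acc L z) - surrogate_correction L z (j 2%N).
Proof.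
move=> Uj z; have [dL _] := L_C2.
rewrite jet_lagrangian2E midpoint_series2 // -/z.
rewrite (funext (midpoint_series0 (surrogate L))).
rewrite [X in _ - _ * X]total_derivative2_lagrangian // -/z.
rewrite derive_midpoint_expansion2; last exact: dL.
rewrite -/z -[surrogate L 2 z]/(surrogate_correction L z (el_acc L z)).
rewrite [X in _ = _ - X]/surrogate_correction -[z.2]/(j 1%N).
cbv zeta; rewrite -/z.
(* Generalizing the scalars leaves [field] an identity between atoms with rational coefficients. *)
move: (surrogate_correction L z (el_acc L z)) => c.
move: (dot (grad_q L z) (j 2%N)) (\sum_(i < n) _) => x0 x1.
move: (dot (j 1%N) (hess_qq L z *m j 1%N)) => x2.
move: (dot (j 2%N) (hess_vv L z *m j 2%N)) (dot (j 2%N) (hess_qv L z *m j 1%N)).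
by move=> x3 x4; field.
Qed.

End MidpointSurrogate.

(** * Elimination of the acceleration and the coefficients up to order h^3 *)

(** The Hessian series is constant up to order [k], hence so is its inverse, and only the term with
    [l = 0] survives in the product of series. It is used twice: at low order to start the
    elimination, and finally for the second claim. *)
Lemma el_acc_series_cst (R : realType) (n : nat) (U : set 'cV[R]_n)
    (L : 'cV[R]_n * 'cV[R]_n -> R) (Lm : nat -> 'cV[R]_n * 'cV[R]_n -> R) k :
  open U ->
  (forall m z, (m <= k)%N -> U z.1 -> Lm m z = cst_series (L z) m) ->
  forall z, U z.1 -> el_acc_series Lm k z = cst_series (el_acc L z) k.
Proof.
move=> oU LmE z Uz.
(* After this replacement, every coefficient of positive order is the zero function everywhere, with
   zero derivatives. *)
rewrite (el_acc_series_local (Lm' := fun m z => cst_series (L z) m) oU LmE) //.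
have part0 (u : 'cV[R]_n * 'cV[R]_n) : 'D_u (fun=> 0 : R) = (fun=> 0).
  by apply/funext => y; exact: derive_cst.
pose A m := hess_vv (fun z => cst_series (L z) m) z.
have A0 m : A m.+1 = 0.
  rewrite -[A _]/(hess_vv (fun=> 0 : R) z).
  by apply/matrixP => i j; rewrite !mxE /partial_v part0; exact: derive_cst.
have invE m : mx_series_inv A m = cst_series (invmx (hess_vv L z)) m.
  case: m => [|m]; rewrite mx_series_invE; first by rewrite big_ord0 subr0 mulmx1.
  rewrite big1 => [|i _]; last by rewrite subSn ?A0 ?mul0mx // -ltnS.
  by rewrite subr0 [_%:M](_ : _ = 0) ?mulmx0 //; apply/matrixP => i j;
    rewrite !mxE mul0rn.
rewrite /el_acc_series big_ord_recl big1 ?addr0 => [|l _].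
  rewrite subn0 invE; case: k {LmE} => [//|k] /=.
  have -> : grad_q (fun=> 0) z = 0.
    by apply/colP => i; rewrite !mxE; exact: derive_cst.
  have -> : hess_qv (fun=> 0) z = 0.
    apply/matrixP => i j; rewrite !mxE /partial_q /partial_v part0.
    exact: derive_cst.
  by rewrite mul0mx subr0 mulmx0.
by rewrite invE mul0mx.
Qed.

Theorem mainTheorem1 (R : realType) (n : nat) (U : set 'cV[R]_n)
    (L : 'cV[R]_n * 'cV[R]_n -> R)
    (U_open : open U)
    (L_smooth : smooth_on (U `*` [set: 'cV[R]_n]) L)
    (L_regular : forall z, U z.1 -> hess_vv L z \in unitmx)
    (Lm : nat -> 'cV[R]_n * 'cV[R]_n -> R)
    (Lm_modified : modified_lagrangian U (surrogate L) Lm) :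
  (forall z, U z.1 ->
     eq_upto 4 (fun k => Lm k z) (cst_series (L z))) /\
  (forall z, U z.1 ->
     eq_upto 4 (fun k => el_acc_series Lm k z) (cst_series (el_acc L z))).
Proof.
have L_C2 := L_smooth 2%N.
have sur_odd l : odd l -> surrogate L l = (fun=> 0).
  by case: l => [|[|[|l]]] //= _; apply/funext.
have jet_odd k : odd k -> jet_lagrangian (surrogate L) k = (fun=> 0).
  exact: jet_lagrangian_odd.
pose g z m : jet R n := fun p => onshell Lm p m z.
(* The term of order 0 is [L (q, q')], and [q] and [q'] receive no corrections in [h] on shell, so
   the composite is constant in [h]. *)
have jet0 z k : (0 < k)%N ->
    subst_coef (jet_lagrangian (surrogate L) 0) (g z) k = 0.
  move=> k0; apply: (@subst_coef_cst _ _ _ _ _ (L z)) => // h.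
  rewrite jet_lagrangian0 /= !fct_sumE !big_ord_recl expr0 !scale1r /=.
  rewrite !big1 ?addr0; first by case: z.
  by move=> i _; exact: scaler0.
have LmS k z : U z.1 -> Lm k z
    = \sum_(0 <= l < k.+1) subst_coef (jet_lagrangian (surrogate L) l) (g z)
                                     (k - l).
  by move=> Uz; rewrite Lm_modified // big_mkord.
have Lm0 z : U z.1 -> Lm 0%N z = L z.
  move=> Uz; rewrite LmS // big_nat1 subst_coef0 jet_lagrangian0.
  by case: z {Uz}.
have Lm1 z : U z.1 -> Lm 1%N z = 0.
  move=> Uz; rewrite LmS // big_ltn // big_nat1 jet0 // (jet_odd 1%N) //.
  by rewrite subst_coef_zero addr0.
(* Agreement of [Lm] with [L] through order [h] already fixes the acceleration through order [h],
   which is all that the next two coefficients use. *)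
have el k z : (k < 2)%N -> U z.1 ->
    el_acc_series Lm k z = cst_series (el_acc L z) k.
  move=> k2 Uz; apply: (el_acc_series_cst U_open) Uz => -[|[|m]] y mk Uy.
  - exact: Lm0.
  - exact: Lm1.
  - by have := leq_ltn_trans mk k2.
(* The parameter [a] is 0 for the coefficient of [h^2] and the variable [h] for that of [h^3]. Since
   the acceleration has no term of order 1, the slot [q''] is [el_acc L z] for every [a]. *)
have jet2 z (a : R) : U z.1 ->
    jet_lagrangian (surrogate L) 2 (g z 0%N + a *: g z 1%N) = 0.
  move=> Uz.
  have gE p : (g z 0%N + a *: g z 1%N) p
      = onshell Lm p 0%N z + a *: onshell Lm p 1%N z by [].
  have g0 : (g z 0%N + a *: g z 1%N) 0%N = z.1.
    by rewrite gE /= scaler0 addr0.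
  have g1 : (g z 0%N + a *: g z 1%N) 1%N = z.2.
    by rewrite gE /= scaler0 addr0.
  have g2 : (g z 0%N + a *: g z 1%N) 2%N = el_acc L z.
    by rewrite gE /= !el //= scaler0 addr0.
  by rewrite (jet_lagrangian2 U_open L_C2) ?g0 // g1 g2 -surjective_pairing subrr.
have Lm2 z : U z.1 -> Lm 2%N z = 0.
  move=> Uz; rewrite LmS // big_ltn // big_ltn // big_nat1 jet0 //.
  rewrite (jet_odd 1%N) // subst_coef_zero !add0r subst_coef0.
  by have := jet2 z 0 Uz; rewrite scale0r addr0.
have Lm3 z : U z.1 -> Lm 3%N z = 0.
  move=> Uz; rewrite LmS // big_ltn // big_ltn // big_ltn // big_nat1 jet0 //.
  rewrite (jet_odd 1%N) // (jet_odd 3%N) // !subst_coef_zero !add0r addr0.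
  (* What remains is the first-order variation of the coefficient of [h^2] along the on-shell jet,
     where [jet2] makes it identically zero. *)
  apply: (@subst_coef_cst _ _ _ _ _ 0) => // h.
  by rewrite big_ord_recl big_ord1 expr0 scale1r; exact: jet2.
have LmE z k : U z.1 -> (k < 4)%N -> Lm k z = cst_series (L z) k.
  by move: k => [|[|[|[|k]]]] // Uz _;
    [exact: Lm0|exact: Lm1|exact: Lm2|exact: Lm3].
split=> z Uz k k4; first exact: LmE.
apply: (el_acc_series_cst U_open) => // m y mk Uy.
by apply: LmE => //; exact: leq_ltn_trans mk k4.
Qed.
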